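(* Let $\mathbb{K}$ be a field, $n \in \mathbb{N}$, $\lambda \in \mathbb{N}_0^n$, and let $G$ be a $\lambda$-lacunary subset of $\mathbb{K}[x_1,\ldots,x_n]$. Let $f \in \mathbb{K}[x_1,\ldots,x_n]$, and let $g \in G$, $\delta \in \mathbb{N}_0^n$ be such that $\mathrm{Lm}(x^\delta g)$ is a monomial of $f$. Let $x^\alpha$ be a $(G,\lambda)$-stable monomial in $f$, let $c \in \mathbb{K} \setminus \{0\}$, and let $h = f - c\, x^\delta g$. Then $x^\alpha$ is a $(G,\lambda)$-stable monomial in $h$.
   Context: Write $x^\alpha = x_1^{\alpha_1}\cdots x_n^{\alpha_n}$; $\operatorname{Mon}(f)$ is the set of monomials appearing in $f$ with nonzero coefficient, $\operatorname{Supp}(f)$ the set of their exponent vectors. For $\alpha,\beta \in \mathbb{N}_0^n$, $\alpha \sqsubseteq \beta$ means $\alpha_i \le \beta_i$ for all $i$. A polynomial $g$ is $\lambda$-lacunary ($\lambda \in \mathbb{N}_0^n$) if it contains a monomial $x^\mu$ such that for every $x^\nu \in \operatorname{Mon}(g)$ and every $i$, $\nu_i < \mu_i - \lambda_i$ or $\nu_i = \mu_i$; then $\nu \sqsubseteq \mu$ for all such $\nu$, and $\mathrm{Lm}(g) := x^\mu$ is the leading monomial of $g$ with respect to every admissible monomial ordering (a total order $\le_a$ on $\mathbb{N}_0^n$ with $\alpha \sqsubseteq \beta \Rightarrow \alpha \le_a \beta$ and $\alpha \le_a \beta \Rightarrow \alpha+\gamma \le_a \beta+\gamma$; $\mathrm{Lm}(p)$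 is the monomial of $p$ with $\le_a$-maximal exponent). A set $G$ is $\lambda$-lacunary if each element is. For $\alpha, \gamma, \lambda \in \mathbb{N}_0^n$ and $\lambda$-lacunary $G$, the monomial $x^\gamma$ is $(G,\lambda,\alpha)$-shading if: (i) $\alpha \sqsubseteq \gamma$ and $\alpha \neq \gamma$; (ii) for every $i$ with $\alpha_i < \gamma_i$ there is $g \in G$ with $\mathrm{Lm}(g) \mid x^\gamma$ and $\deg_{x_i}(g) > 0$; (iii) for every $i$ with $\alpha_i < \gamma_i$ we have $\alpha_i + \lambda_i < \gamma_i$. The monomial $x^\alpha$ is $(G,\lambda)$-stable in $f$ if: (i) $\alpha \in \operatorname{Supp}(f)$; (ii) there is no $g \in G$ with $\mathrm{Lm}(g) \mid x^\alpha$; (iii) no monomial in $\operatorname{Mon}(f)$ is $(G,\lambda,\alpha)$-shading. *)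

(* Defs.v *)
From HB Require Import structures.
From mathcomp Require Import all_boot all_order all_algebra.
From mathcomp.multinomials Require Export mpoly.

Set Implicit Arguments.
Unset Strict Implicit.
Unset Printing Implicit Defensive.

Import Order.TTheory GRing.Theory.
Local Open Scope ring_scope.

(* Monomials are identified with their exponent vectors in 'X_{1..n}, so
   Mon(f) and Supp(f) are both [msupp f], and both the componentwise order on
   exponents and divisibility of monomials are [(_ <= _)%MM]. *)

Section Definitions.

Variables (n : nat) (K : fieldType).
Implicit Types (lam mu nu al ga de : 'X_{1..n}) (f g : {mpoly K[n]}).
Implicit Types (G : {mpoly K[n]} -> Prop).

(* Truncated subtraction is harmless: [nu i < mu i - lam i] in nat is
   equivalent to [nu i + lam i < mu i]. *)
Definition lacunary_at lam g mu : Prop :=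
  mu \in msupp g /\
  forall nu, nu \in msupp g ->
    forall i : 'I_n, (nu i < mu i - lam i)%N \/ nu i = mu i.

Definition lacunary lam g : Prop := exists mu, lacunary_at lam g mu.

Definition lacunary_set lam G : Prop := forall g, G g -> lacunary lam g.

(* The degree of [g] in the single variable 'X_i (0 when [g = 0]). *)
Definition degree_in (i : 'I_n) g : nat := \max_(m <- msupp g) m i.

(* Lm is the library's [mlead], the maximal monomial for one particular
   admissible ordering; on lacunary polynomials the choice of ordering is
   irrelevant, see [lacunary_at_mlead] and [lacunary_mlead_admissible]. *)
Definition shading G lam al ga : Prop :=
  [/\ (al <= ga)%MM /\ al <> ga,
      forall i : 'I_n, (al i < ga i)%N ->
        exists g, [/\ G g, (mlead g <= ga)%MM & (0 < degree_in i g)%N]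
    & forall i : 'I_n, (al i < ga i)%N -> (al i + lam i < ga i)%N].

Definition stable G lam f al : Prop :=
  [/\ al \in msupp f,
      ~ (exists g, G g /\ (mlead g <= al)%MM)
    & ~ (exists ga, ga \in msupp f /\ shading G lam al ga)].

Definition admissible (le : rel 'X_{1..n}) : Prop :=
  [/\ reflexive le /\ antisymmetric le, transitive le, total le,
      forall al be : 'X_{1..n}, (al <= be)%MM -> le al be
    & forall al be ga : 'X_{1..n}, le al be -> le (al + ga)%MM (be + ga)%MM].

Lemma lacunary_at_lepm lam g mu nu :
  lacunary_at lam g mu -> nu \in msupp g -> (nu <= mu)%MM.
Proof.
move=> [_ h] /h hnu; apply/mnm_lepP => i.
by case: (hnu i) => [lt|->//]; apply/ltnW/(leq_trans lt)/leq_subr.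
Qed.

Lemma lacunary_at_mlead lam g mu : lacunary_at lam g mu -> mlead g = mu.
Proof.
move=> h; have [mug _] := h; apply/eqP; rewrite eq_le (msupp_le_mlead mug) andbT.
apply/lem_leo/(lacunary_at_lepm h)/mlead_supp.
by apply: contraTneq mug => ->; rewrite msupp0.
Qed.

Lemma lacunary_mlead_admissible (le : rel 'X_{1..n}) lam g :
  admissible le -> lacunary lam g ->
  mlead g \in msupp g /\ forall nu, nu \in msupp g -> le nu (mlead g).
Proof.
move=> [_ _ _ hle _] [mu h]; rewrite (lacunary_at_mlead h).
by split=> [|nu nug]; [case: h | apply/hle/(lacunary_at_lepm h)].
Qed.

Lemma admissible_mnmc_le : admissible (fun al be => (al <= be)%O).
Proof.
split=> [|||al be|al be ga le]; last by apply: lem_add.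
- by split; [exact: lexx | exact: le_anti].
- exact: le_trans.
- exact: le_total.
- exact: lem_leo.
Qed.

(* Hence [mlead ('X_[de] * g)] is also independent of the ordering. *)
Lemma lacunary_mulX lam de g : lacunary lam g -> lacunary lam ('X_[de] * g).
Proof.
move=> [mu [mug h]]; exists (de + mu)%MM.
rewrite mulrC; split=> [|nu].
  by rewrite (perm_mem (msuppMX _ _)); apply/map_f.
rewrite (perm_mem (msuppMX _ _)) => /mapP[nu' /h hnu ->] i.
rewrite !mnmDE; case: (hnu i) => [|->]; last by right.
by rewrite !ltn_subRL addnCA ltn_add2l; left.
Qed.

End Definitions.

(* Main.v *)
(* Let [M] be the leading monomial of [x^de g], which occurs in [f]. A monomial
   [ga] of [x^de g] that equals [x^al] or shades it would make [M] shade [x^al]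
   in [f]: where [M] exceeds [ga], lacunarity supplies the gap and [g] itself is
   the witness. So [x^al] does not occur in [x^de g], whence it survives in [h],
   and no shading monomial of [h] can come from [x^de g]. *)
Require Import Defs.
From HB Require Import structures.
From mathcomp Require Import all_boot all_order all_algebra.

Local Open Scope ring_scope.

(** Allowing [al = ga] lets one argument serve both for the survival of [al] and for its possible
    shaders. At indices where [ga] agrees with the leading exponent, the conditions are inherited
    from [ga]. *)
Lemma shading_mlead_mulX (K : fieldType) (n : nat) (lam de al ga : 'X_{1..n})
    (G : {mpoly K[n]} -> Prop) (g : {mpoly K[n]}) :
  lacunary lam g -> G g -> ~~ (mlead g <= al)%MM ->
  ga \in msupp ('X_[de] * g) -> al = ga \/ shading G lam al ga ->
  shading G lam al (mlead ('X_[de] * g)).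
Proof.
move=> [mu lac] Gg Nal gaS alga; have [mug h] := lac.
have g0 : g != 0 by apply: contraTneq mug => ->; rewrite msupp0.
have X0 : 'X_[de] != 0 :> {mpoly K[n]} by rewrite -msupp_eq0 msuppX.
rewrite (mleadM X0 g0) mleadXm (lacunary_at_mlead lac) in Nal *.
move: gaS; rewrite GRing.mulrC (perm_mem (msuppMX _ _)) => /mapP[nu nug ega].
have le_ga_M : (ga <= de + mu)%MM.
  by rewrite ega; apply/mnm_lepP => i; rewrite !mnmDE leq_add2l;
     move/mnm_lepP: (lacunary_at_lepm lac nug).
have le_mu_M : (mu <= de + mu)%MM by exact: lem_addl.
have le_al_ga : (al <= ga)%MM.
  by case: alga => [->|[[]]//]; exact: lepm_refl.
(* Vacuous when [al = ga], so the two cases merge from here on. *)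
have gap i : (al i < ga i)%N ->
    (exists g', [/\ G g', (mlead g' <= ga)%MM & (0 < degree_in i g')%N]) /\
    (al i + lam i < ga i)%N.
  by case: alga => [->|[_ w l] lt]; [rewrite ltnn|split; [exact: w|exact: l]].
(* Lacunarity of [g], shifted by [de]. The extra [nu i < mu i] forces [mu i] to be positive, so that
   [g] involves the variable [i]. *)
have dich i : ((ga i + lam i < (de + mu)%MM i)%N /\ (nu i < mu i)%N) \/
    ga i = (de + mu)%MM i.
  rewrite ega !mnmDE; case: (h _ nug i) => [lt|->]; last by right.
  left; split; last by apply: leq_trans lt (leq_subr _ _).
  by rewrite -addnA ltn_add2l addnC -ltn_subRL.
split=> [|i lt|i lt].
(* [mu] divides [de + mu] but not [al], so the two differ. *)
- split; last by move=> e; rewrite e le_mu_M in Nal.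
  exact: lepm_trans le_al_ga le_ga_M.
- case: (dich i) => [[_ lt_nu]|e].
    exists g; split=> //; first by rewrite (lacunary_at_mlead lac).
    apply: leq_trans (leq_ltn_trans (leq0n _) lt_nu) _.
    exact: (leq_bigmax_seq _ mug).
  have [[g' [Gg' le' deg']] _] : _ := gap i (etrans (congr1 (leq _) e) lt).
  by exists g'; split=> //; apply: lepm_trans le' le_ga_M.
- case: (dich i) => [[lt_ga _]|e]; last by rewrite -e in lt *; case: (gap i lt).
  (* As [al i <= ga i], the gap above [ga i] is also one above [al i]. *)
  by apply: leq_ltn_trans lt_ga; rewrite leq_add2r; apply/mnm_lepP.
Qed.

Theorem theorem4p4 (K : fieldType) (n : nat) (hn : (0 < n)%N)
    (lam : 'X_{1..n}) (G : {mpoly K[n]} -> Prop) (hG : lacunary_set lam G)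
    (f g : {mpoly K[n]}) (de : 'X_{1..n}) (hg : G g)
    (hf : mlead ('X_[de] * g) \in msupp f)
    (al : 'X_{1..n}) (hal : stable G lam f al)
    (c : K) (hc : c != 0)
    (h : {mpoly K[n]}) (hh : h = f - c *: ('X_[de] * g)) :
  stable G lam h al.
Proof.
have [alf Nal Nsh] := hal.
have Nalg : ~~ (mlead g <= al)%MM by apply/negP => le; apply: Nal; exists g.
have NM ga : al = ga \/ shading G lam al ga -> ('X_[de] * g)@_ga = 0.
  move=> alga; apply/memN_msupp_eq0/negP => gaS.
  by apply: Nsh; exists (mlead ('X_[de] * g)); split=> //;
     apply: shading_mlead_mulX gaS alga => //; apply: hG.
(* At these exponents the subtracted multiple of x^de g has coefficient 0. *)
have supp_h ga : al = ga \/ shading G lam al ga ->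
    (ga \in msupp h) = (ga \in msupp f).
  by move=> /NM e; rewrite !mcoeff_msupp hh mcoeffB mcoeffZ e GRing.mulr0 GRing.subr0.
split=> //; first by rewrite supp_h //; left.
move=> [ga [gah sh]]; apply: Nsh; exists ga; split=> //.
by rewrite -supp_h //; right.
Qed.
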